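(* Let $(M,d)$ be a proper geodesic metric space and let $\rho:\Gamma\to\mathrm{LHomeo}(M)$ be an action that is meandering-hyperbolic at a non-empty compact invariant subset $\Lambda\subset M$, no point of which is isolated in $M$, with datum $(\mathcal D_0\prec\mathcal D;N)$. Then there exist a compact set $K\supset\Lambda$, a constant $\epsilon=\epsilon(\mathcal D,N)>0$, and for every $\rho'\in U(\rho;K,\epsilon)$ a compact subset $\Lambda'=\Lambda'_{\rho'}\subset M$ and a map $\phi=\phi_{\rho'}:\Lambda\to M$ such that: (1) ($\rho$ is structurally stable in the sense of Lipschitz dynamics) for every $\rho'\in U(\rho;K,\epsilon)$, the set $\Lambda'$ is $\rho'$-invariant and $\phi$ is an equivariant homeomorphism $\Lambda\to\Lambda'$, that is, $\rho'(g)\circ\phi=\phi\circ\rho(g)$ on $\Lambda$ for all $g\in\Gamma$; (2) the map $U(\rho;K,\epsilon)\to C^0(\Lambda,M)$, $\rho'\mapsto\phi$, is continuous at $\rho$; (3) every action $\rho'\in U(\rho;K,\epsilon)$ is expanding at $\Lambda'$. If $\rho$ is uniformly meandering-hyperbolic at $\Lambda$ (with datum $(\mathcal D_0\prec\mathcal D;N)$), then in addition: (4) every action $\rho'\in U(\rho;K,\epsilon)$ is again uniformly meandering-hyperbolic (at $\Lambda'$).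
   Context: Conventions: $\mathbb N_0=\{0,1,2,\dots\}$, $\mathbb N=\{1,2,\dots\}$; $B_r(x)$ is the open $r$-ball, $N_r(\Lambda)$ the open $r$-neighborhood. A metric space is proper if its closed balls are compact, geodesic if any two points are joined by an isometrically embedded interval. $\mathrm{LHomeo}(M)$ is the group of homeomorphisms of $M$ whose restrictions to compact subsets are bi-Lipschitz. Expansion. Let $f$ be a homeomorphism of $M$, $\lambda>1$, $U\subset M$, $\delta>0$. $f$ is $(\lambda,U)$-expanding if $d(f(x),f(y))\ge\lambda d(x,y)$ for all $x,y\in U$; it is $(\lambda,U;\delta)$-expanding if moreover $B_{\lambda\eta}(f(x))\subset f(B_\eta(x))$ whenever $B_\eta(x)\subset U$ and $\eta\le\delta$. For an open cover $\mathcal U$ of $\Lambda$, $\delta_{\mathcal U}$ is the supremum of its Lebesgue numbers (numbers $\delta>0$ such that for every $x\in\Lambda$ the ball $B_\delta(x)$ lies in a member of $\mathcal U$). An action $\rho$ with non-empty compact invariant subset $\Lambda$, no point of which is isolated in $M$, is expanding at $\Lambda$ if there are a finite index set $\mathcal I$, a cover $\mathcal U=\{U_i\mid i\in\mathcal I\}$ of $\Lambda$ by open (possibly empty) subsets of $M$, a map $\mathcal I\to\Gamma$, $i\mapsto s_i$, and real numbers $L\ge\lambda>1$ and $0<\delta\le\delta_{\mathcal U}$ such that for each $i$ the map $\rho(s_i^{-1})$ is $L$-Lipschitz on $N_\delta(\Lambda)$ and $(\lambda,U_i;\delta)$-expanding, and $\Sigma=\{s_i\mid i\in\mathcal I\}$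 is a symmetric generating set of $\Gamma$. Then $\mathcal D=(\mathcal I,\mathcal U,\Sigma,\delta,L,\lambda)$ is an expansion datum of $\rho$; $d_\Sigma$ is the word metric on $\Gamma$. Codes and rays. Let $x\in\Lambda$, $0<\eta\le\delta$. For $\alpha:\mathbb N_0\to\mathcal I$ put $p_0=x$, $p_{k+1}=\rho(s_{\alpha(k)}^{-1})(p_k)$. $\alpha$ is a $(\mathcal D,\eta)$-code for $x$ if $B_\eta(p_k)\subset U_{\alpha(k)}$ for every $k\in\mathbb N$ (nothing is required for $k=0$). Its ray is $c^\alpha:\mathbb N_0\to\Gamma$, $c^\alpha_k=s_{\alpha(0)}s_{\alpha(1)}\cdots s_{\alpha(k)}$. $\mathrm{Ray}_x(\mathcal D,\eta)$ is the set of rays of all $(\mathcal D,\eta)$-codes for $x$. Refinement. For expansion data $\mathcal D_k=(\mathcal I_k,\mathcal U_k,\Sigma_k,\delta_k,L_k,\lambda_k)$, $k=0,1$, of $\rho$, write $\mathcal D_0\prec\mathcal D_1$ ($\mathcal D_1$ is a refinement of $\mathcal D_0$) if $\mathcal I_0\subset\mathcal I_1$, $U_{0,i}\subset U_{1,i}$ and $s_{0,i}=s_{1,i}$ for all $i\in\mathcal I_0$, $\delta_0>\delta_1$, $L_0\le L_1$, $\lambda_0\ge\lambda_1$. Then for $\eta\le\delta_1$, $\mathrm{Ray}_x(\mathcal D_0,\eta)\subset\mathrm{Ray}_x(\mathcal D_1,\eta)$. Equivalence. For $N\in\mathbb N_0$, write $c^\alpha\approx^N_{(\mathcal D,\eta)}c^\beta$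 for $c^\alpha,c^\beta\in\mathrm{Ray}_x(\mathcal D,\eta)$ if there are infinite subsets $P,Q\subset\mathbb N_0$ such that $\{c^\alpha_k\mid k\in P\}$ and $\{c^\beta_j\mid j\in Q\}$ are within Hausdorff distance $N$ in $(\Gamma,d_\Sigma)$. $(\mathcal D,\eta;N)$-equivalence is the equivalence relation on $\mathrm{Ray}_x(\mathcal D,\eta)$ generated by $\approx^N_{(\mathcal D,\eta)}$. Meandering hyperbolicity. $\rho$ is meandering-hyperbolic at $\Lambda$ with datum $(\mathcal D_0\prec\mathcal D;N)$ if $\mathcal D_0$ is an expansion datum (with constant $\delta_0$), $\mathcal D\succ\mathcal D_0$ a refinement (with constant $\delta$) and $N\ge1$ an integer such that for every $x\in\Lambda$ all rays in $\mathrm{Ray}_x(\mathcal D_0,\delta_0)$ are $(\mathcal D,\delta;N)$-equivalent (as rays in $\mathrm{Ray}_x(\mathcal D,\delta)$). It is uniformly meandering-hyperbolic with datum $(\mathcal D_0\prec\mathcal D;N)$ if for every $\eta\in(0,\delta]$ and every $x\in\Lambda$ all rays in $\mathrm{Ray}_x(\mathcal D_0,\eta)$ are $(\mathcal D,\eta;N)$-equivalent. An action is (uniformly) meandering-hyperbolic if it is so with some datum. Perturbations. For compact $K\subset M$ and $f,g\in\mathrm{LHomeo}(M)$ let $d_{\mathrm{Lip},K}(f,g)=\sup_{x\in K}d(f(x),g(x))+\sup_{x\ne y\in K}\left|\frac{d(f(x),f(y))}{d(x,y)}-\frac{d(g(x),g(y))}{d(x,y)}\right|$. The compact-open Lipschitz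 topology on $\mathrm{LHomeo}(M)$ is generated by the sets $\{g\mid d_{\mathrm{Lip},K}(f,g)<\epsilon\}$. With $\mathcal I$ and $s_i$ from the datum $\mathcal D$, $U(\rho;K,\epsilon)$ is the set of homomorphisms $\rho':\Gamma\to\mathrm{LHomeo}(M)$ with $d_{\mathrm{Lip},K}(\rho(s_i),\rho'(s_i))<\epsilon$ for all $i\in\mathcal I$. $\mathrm{Hom}(\Gamma,\mathrm{LHomeo}(M))$ is topologized as a subspace of $\mathrm{LHomeo}(M)^{\mathcal I}$ via $\rho'\mapsto(\rho'(s_i))_{i\in\mathcal I}$. $C^0(\Lambda,M)$ carries the uniform topology. *)

(* Defs.v *)
From HB Require Import structures.
From Stdlib Require Import Relation_Operators.
From mathcomp Require Import all_boot all_order all_algebra.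
From mathcomp Require Import all_classical all_reals all_analysis.

Set Implicit Arguments.
Unset Strict Implicit.
Unset Printing Implicit Defensive.

Import Order.TTheory GRing.Theory Num.Theory.

Local Open Scope classical_set_scope.
Local Open Scope ring_scope.

Section MetricSpaces.
Context {R : realType} {M : metricType R}.
Implicit Types (x y : M) (A K U : set M) (f : M -> M) (r delta L lambda : R).

Definition proper_space :=
  forall (x : M) (r : R), compact [set y | mdist x y <= r].

Definition geodesic_space :=
  forall x y : M, exists c : R -> M,
    [/\ c 0 = x, c (mdist x y) = y &
        forall s t, 0 <= s <= mdist x y -> 0 <= t <= mdist x y ->
          mdist (c s) (c t) = `|s - t| ].

Definition nbhd A r : set M := \bigcup_(x in A) ball x r.

Definition lipschitz_in L A f :=
  forall x y, A x -> A y -> mdist (f x) (f y) <= L * mdist x y.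

Definition bilipschitz_in A f :=
  exists2 L : R, 1 <= L & forall x y, A x -> A y ->
    L^-1 * mdist x y <= mdist (f x) (f y) <= L * mdist x y.

Definition expanding_on lambda U f :=
  forall x y, U x -> U y -> lambda * mdist x y <= mdist (f x) (f y).

Definition expanding_on_upto lambda U delta f :=
  expanding_on lambda U f /\
  forall x (eta : R), 0 < eta -> eta <= delta -> ball x eta `<=` U ->
    ball (f x) (lambda * eta) `<=` f @` ball x eta.

(* Since [ereal_sup set0 = -oo], a cover without any Lebesgue number gets
   value [-oo], and the value is [+oo] if the Lebesgue numbers are unbounded. *)
Definition lebesgue_sup (I : Type) A (U : I -> set M) : \bar R :=
  ereal_sup [set r%:E | r in
    [set r : R | 0 < r /\ forall x, A x -> exists i, ball x r `<=` U i]].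

Definition homeo_onto A B f :=
  [/\ {within A, continuous f}, f @` A = B &
      exists2 g : M -> M, {within B, continuous g} &
        forall x, A x -> g (f x) = x].

End MetricSpaces.

Arguments proper_space {R} M.
Arguments geodesic_space {R} M.

Section LHomeo.
Context {R : realType} (M : metricType R).

Definition is_lhomeo (f : M -> M) :=
  [/\ continuous f,
      exists g : M -> M, [/\ continuous g, cancel f g & cancel g f] &
      forall K : set M, compact K -> bilipschitz_in K f].

Record lhomeo := LHomeo {
  lhomeo_fun :> M -> M ;
  lhomeo_prop : is_lhomeo lhomeo_fun }.

(* Supremum in [0, +oo], so that suprema over the empty set are 0. *)
Definition nneg_sup (A : set R) : \bar R :=
  ereal_sup (0%E |` [set r%:E | r in A]).

Definition dLip (K : set M) (f g : lhomeo) : \bar R :=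
  (nneg_sup [set mdist (f x) (g x) | x in K] +
   nneg_sup [set r | exists x y, [/\ K x, K y, x <> y &
     r = (`| mdist (f x) (f y) / mdist x y -
             mdist (g x) (g y) / mdist x y |)%R ]])%E.

Definition lhomeo_subbase : set (set lhomeo) :=
  [set V | exists (f : lhomeo) (K : set M) (e : R),
    [/\ compact K, 0 < e & V = [set g | (dLip K f g < e%:E)%E]]].

HB.instance Definition _ := gen_eqMixin lhomeo.
HB.instance Definition _ := gen_choiceMixin lhomeo.
HB.instance Definition _ := isSubBaseTopological.Build lhomeo lhomeo_subbase id.

End LHomeo.

Section Groups.
Local Open Scope group_scope.
Context {R : realType} {G : groupType}.
Implicit Types (S : set G) (g h : G).

Definition symmetric_set S := forall g, S g -> S g^-1.

Definition generating_set S :=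
  forall H : set G, H 1 -> (forall g h, H g -> H h -> H (g * h^-1)) ->
    S `<=` H -> forall g, H g.

Definition word_length S g : \bar R :=
  ereal_inf [set ((size w)%:R%R)%:E | w in
    [set w : seq G | (forall s, s \in w -> S s) /\ g = \prod_(s <- w) s]].

Definition word_dist S g h : \bar R := word_length S (g^-1 * h).

End Groups.

Definition hausdorff_dist {R : realType} (T : Type) (d : T -> T -> \bar R)
    (A B : set T) : \bar R :=
  maxe (ereal_sup [set ereal_inf [set d a b | b in B] | a in A])
       (ereal_sup [set ereal_inf [set d a b | a in A] | b in B]).

Section Actions.
Context {R : realType} (M : metricType R) (G : groupType).

Record action := Action {
  act :> G -> lhomeo M ;
  actM : forall g h x, act (g * h)%g x = act g (act h x) }.

HB.instance Definition _ := gen_eqMixin action.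
HB.instance Definition _ := gen_choiceMixin action.

Record expansion_datum := ExpansionDatum {
  ed_index : finType ;
  ed_cover : ed_index -> set M ;
  ed_gen : ed_index -> G ;
  ed_delta : R ;
  ed_L : R ;
  ed_lambda : R }.

Arguments ed_cover : clear implicits.
Arguments ed_gen : clear implicits.

Definition ed_Sigma (D : expansion_datum) : set G := range (ed_gen D).

Definition hom_gens (D : expansion_datum) (rho : action) :
    prod_topology (fun _ : ed_index D => lhomeo M) :=
  fun i => rho (ed_gen D i).

Arguments hom_gens : clear implicits.

Definition hom_space (D : expansion_datum) :=
  initial_topology (hom_gens D).

HB.instance Definition _ (D : expansion_datum) :=
  Topological.on (hom_space D).

End Actions.

Arguments ed_cover {R M G} _ _.
Arguments ed_gen {R M G} _ _.
Arguments hom_gens {R M G} D rho i.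


Section MeanderingHyperbolicity.
Context {R : realType} {M : metricType R} {G : groupType}.
Local Notation datum := (expansion_datum M G).
Implicit Types (rho : action M G) (Lambda K : set M) (D : datum)
  (x : M) (eta : R) (N : nat) (c : nat -> G).

Definition invariant_set rho Lambda := forall g, rho g @` Lambda = Lambda.

Definition is_expansion_datum rho Lambda D :=
  [/\ [/\ Lambda !=set0, compact Lambda, invariant_set rho Lambda &
          forall x, Lambda x -> ~ isolated [set: M] x],
      (forall i, open (ed_cover D i)) /\
        Lambda `<=` \bigcup_i ed_cover D i,
      [/\ 1 < ed_lambda D, ed_lambda D <= ed_L D, 0 < ed_delta D &
          ((ed_delta D)%:E <= lebesgue_sup Lambda (ed_cover D))%E],
      forall i : ed_index D,
        lipschitz_in (ed_L D) (nbhd Lambda (ed_delta D))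
          (rho (ed_gen D i)^-1%g) /\
        expanding_on_upto (ed_lambda D) (ed_cover D i) (ed_delta D)
          (rho (ed_gen D i)^-1%g) &
      symmetric_set (ed_Sigma D) /\ generating_set (ed_Sigma D)].

Definition expanding rho Lambda := exists D, is_expansion_datum rho Lambda D.

Fixpoint code_point rho D (alpha : nat -> ed_index D) x (k : nat) : M :=
  if k is k'.+1 then rho (ed_gen D (alpha k'))^-1%g (code_point rho alpha x k')
  else x.

Definition is_code rho D eta x (alpha : nat -> ed_index D) :=
  forall k, (0 < k)%N ->
    ball (code_point rho alpha x k) eta `<=` ed_cover D (alpha k).

Definition ray_of D (alpha : nat -> ed_index D) : nat -> G :=
  fun k => (\prod_(0 <= i < k.+1) ed_gen D (alpha i))%g.

Definition Ray rho D eta x : set (nat -> G) :=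
  [set ray_of alpha | alpha in is_code rho eta x (D := D)].

(* The inclusion of index sets [I_0 <= I_1] is an injection of finite types. *)
Definition refinement D0 D1 :=
  (exists iota : ed_index D0 -> ed_index D1,
     injective iota /\
     forall i, ed_cover D0 i `<=` ed_cover D1 (iota i) /\
               ed_gen D0 i = ed_gen D1 (iota i)) /\
  [/\ ed_delta D1 < ed_delta D0, ed_L D0 <= ed_L D1 &
      ed_lambda D1 <= ed_lambda D0].

Definition ray_approx rho D eta N x c c' :=
  [/\ Ray rho D eta x c, Ray rho D eta x c' &
      exists P Q : set nat, [/\ infinite_set P, infinite_set Q &
        (hausdorff_dist (word_dist (R := R) (ed_Sigma D)) (c @` P) (c' @` Q)
           <= N%:R%:E)%E]].

Definition ray_equiv rho D eta N x c c' :=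
  [/\ Ray rho D eta x c, Ray rho D eta x c' &
      clos_refl_sym_trans _ (ray_approx rho D eta N x) c c'].

Definition meandering_hyperbolic_with rho Lambda D0 D N :=
  [/\ is_expansion_datum rho Lambda D0, is_expansion_datum rho Lambda D,
      refinement D0 D, (1 <= N)%N &
      forall x, Lambda x -> forall c c',
        Ray rho D0 (ed_delta D0) x c -> Ray rho D0 (ed_delta D0) x c' ->
        ray_equiv rho D (ed_delta D) N x c c'].

Definition unif_meandering_hyperbolic_with rho Lambda D0 D N :=
  [/\ is_expansion_datum rho Lambda D0, is_expansion_datum rho Lambda D,
      refinement D0 D, (1 <= N)%N &
      forall eta, 0 < eta -> eta <= ed_delta D ->
      forall x, Lambda x -> forall c c',
        Ray rho D0 eta x c -> Ray rho D0 eta x c' ->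
        ray_equiv rho D eta N x c c'].

Definition unif_meandering_hyperbolic rho Lambda :=
  exists D0 D N, unif_meandering_hyperbolic_with rho Lambda D0 D N.

Definition Hom_nbhd D rho K (eps : R) : set (action M G) :=
  [set rho' : action M G | forall i : ed_index D,
    (dLip K (rho (ed_gen D i)) (rho' (ed_gen D i)) < eps%:E)%E].

End MeanderingHyperbolicity.

(* Main.v *)
Require Import Defs.
From Stdlib Require Import Relation_Operators.
From mathcomp Require Import all_boot all_order all_algebra.
From mathcomp Require Import all_classical all_reals all_analysis.
From mathcomp Require Import finmap lra.

(** The conjugacy is obtained by shadowing.  If B_delta(x) lies in U_i, then
    rho(s_i) is (1/lambda)-Lipschitz on B_delta(rho(s_i^-1) x), so rho'(s_i)
    still contracts that ball by a factor theta < 1 and maps it into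
    B_delta(x).  Hence for a code of x with ray c, exactly one point y has its
    rho'(c_k^-1)-orbit within r = epsilon / (1 - theta) of the orbit of x.
    For rays related by the N-approximation both orbits are, at infinitely
    many times, moved onto each other by words of length at most N, which
    multiply the error by at most (L+1)^N; as r (L+1)^N < delta, the two
    shadowing points agree.  Meandering hyperbolicity thus makes y depend on
    x only, and phi x := y.  Prefixing a code of x by a generator s gives a
    code of s x (nothing is required at k = 0), whence equivariance and
    d(x, phi x) <= r.  Expansion at x and contraction backwards give moduli of
    continuity for phi and its inverse.  An expansion datum of rho' comes from
    replacing U_i by the balls around phi q for those q such that U_i contains
    a fixed ball around q; then codes of rho' at any small scale are codes of
    rho at the single scale delta/2, where uniformity applies. *)

Set Implicit Arguments.
Unset Strict Implicit.
Unset Printing Implicit Defensive.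

Import Order.TTheory GRing.Theory Num.Theory numFieldNormedType.Exports.

Local Open Scope classical_set_scope.
Local Open Scope ring_scope.

(** * Metric preliminaries *)

Lemma geometric_small (R : realType) (q a t : R) : 0 < q < 1 -> 0 < t ->
  exists n, forall k, (n <= k)%N -> q ^+ k * a < t.
Proof.
move=> q01 t0.
have cvg0 : q ^+ n * a @[n --> \oo] --> 0 * a.
  by apply: cvgMl; apply: cvg_expr; rewrite gtr0_norm; lra.
rewrite mul0r in cvg0.
have [n _ Hn] := cvgr_lt _ cvg0 _ t0.
by exists n.
Qed.

Section Metric.
Context {R : realType} {M : metricType R}.
Implicit Types (x y z : M) (A K : set M).

Lemma ballP x y (r : R) : ball x r y <-> mdist x y < r.
Proof. by rewrite ballEmdist. Qed.

Lemma open_mball x (t : R) : open (ball x t).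
Proof.
rewrite openE => y /ballP xy; apply/metricType_numDomainType.nbhs_mdistP.
exists (t - mdist x y) => [|z /= yz]; first by rewrite /= subr_gt0.
by apply/ballP; have := metric_triangle x y z; lra.
Qed.

Lemma mdist_le_sum x y z (a b : R) :
  mdist x y <= a -> mdist y z <= b -> mdist x z <= a + b.
Proof. by move=> xy yz; apply: le_trans (metric_triangle x y z) (lerD xy yz). Qed.

Lemma continuous_mdistP (f : M -> M) x (e : R) : continuous f -> 0 < e ->
  exists2 d : R, 0 < d & forall y, mdist x y < d -> mdist (f x) (f y) < e.
Proof.
move=> fc e0.
have /metricType_numDomainType.cvgrPdist_lt/(_ e e0) := fc x.
move=> /metricType_numDomainType.nbhs_mdistP[d d0 H].
by exists d.
Qed.

Lemma within_continuous_mdist A (f : M -> M) :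
  (forall x (e : R), A x -> 0 < e -> exists2 d : R, 0 < d &
     forall y, A y -> mdist x y < d -> mdist (f x) (f y) < e) ->
  {within A, continuous f}.
Proof.
move=> H; apply/subspace_continuousP => x Ax.
apply/metricType_numDomainType.cvgrPdist_lt => e e0.
have [d d0 Hd] := H x e Ax e0.
rewrite near_withinE; apply/metricType_numDomainType.nbhs_mdistP.
by exists d => //= y /= xy Ay; apply: Hd.
Qed.

(** A closed condition that holds along a filter passes to its cluster points; this is the limit
    step in the construction of shadowing points. *)
Lemma cluster_mdist_le (F : set_system M) (f : M -> M) p x (r : R) :
  continuous f -> cluster F p -> F [set y | mdist x (f y) <= r] ->
  mdist x (f p) <= r.
Proof.
move=> fc Fp Fr; apply/ler_addgt0Pr => e e0.
have [d d0 Hd] := continuous_mdistP p fc e0.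
have [] := Fp _ [set y | mdist p y < d] Fr.
  by apply/metricType_numDomainType.nbhs_mdistP; exists d.
move=> y [/= xy /Hd /ltW]; rewrite metric_sym => ypf.
exact: mdist_le_sum xy ypf.
Qed.

Lemma compact_mdist_bounded A x : compact A ->
  exists2 r : R, 0 <= r & forall y, A y -> mdist x y <= r.
Proof.
move=> Ac; apply: contrapT => nb.
have far (n : nat) : exists y, A y /\ n%:R < mdist x y.
  apply: contrapT => H; apply: nb; exists n%:R => // y Ay.
  by rewrite leNgt; apply/negP => ny; apply: H; exists y.
have [u Hu] := choice far.
have [|p [_ up]] := Ac (u @ \oo) _.
  by exists 0%N => // n _; have [] := Hu n.
have [k Hk] : exists k : nat, mdist x p + 1 < k%:R.
  by exists (Num.bound (mdist x p + 1)); apply: archi_boundP; rewrite addr_ge0 ?mdist_ge0.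
have [] := up [set y | k%:R < mdist x y] [set y | mdist p y < 1].
- exists k => // n /= kn; apply: le_lt_trans (proj2 (Hu n)).
  by rewrite ler_nat.
- by apply/metricType_numDomainType.nbhs_mdistP; exists 1 => /=.
- by move=> y [/= y1 y2]; have := metric_triangle x p y; lra.
Qed.

(** A geodesic leaving [z] has points at every small positive distance from [z]; the pair [x], [y]
    supplies an endpoint other than [z]. *)
Lemma geodesic_not_isolated x y z :
  geodesic_space M -> x != y -> ~ isolated [set: M] z.
Proof.
move=> geo xy [_ [V]].
move=> /metricType_numDomainType.nbhs_mdistP[e /= e0 eV]; rewrite setIT => Vz.
have [w zw] : exists w, 0 < mdist z w.
  have [<-|nzx] := eqVneq x z; first by exists y; rewrite mdist_gt0.
  by exists x; rewrite mdist_gt0 eq_sym.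
have [c [c0 _ cd]] := geo z w.
pose t := Num.min (e / 2) (mdist z w).
have t0 : 0 < t by rewrite lt_min zw divr_gt0.
have tw : t <= mdist z w by rewrite ge_min lexx orbT.
have te : t < e by rewrite gt_min; apply/orP; left; lra.
have zt : mdist z (c t) = t.
  by rewrite -{1}c0 cd ?lexx ?mdist_ge0 ?(ltW t0)// sub0r normrN gtr0_norm.
have : V (c t) by apply: eV; rewrite /= zt.
rewrite Vz /= => ctz; move: zt t0; rewrite ctz mdistxx => <-.
by rewrite ltxx.
Qed.

(* The supremum of the Lebesgue numbers is itself one, as the cover is finite. *)
Lemma lebesgue_supP (I : finType) A (U : I -> set M) (d : R) x :
  (d%:E <= lebesgue_sup A U)%E -> A x -> exists i, ball x d `<=` U i.
Proof.
move=> dU Ax; apply: contrapT => nU.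
have out i : exists y, mdist x y < d /\ ~ U i y.
  apply: contrapT => H; apply: nU; exists i => y /ballP xy.
  by apply: contrapT => nUy; apply: H; exists y.
have [u Hu] := choice out.
have [m md Hm] : exists2 m, m < d & forall i, mdist x (u i) <= m.
  (* The base value [d - 1] lies below [d], so [m < d] holds for an empty index type as well. *)
  pose m := \big[Num.max/(d - 1)]_i mdist x (u i).
  exists m; last by move=> i; apply: le_bigmax.
  by apply/bigmax_ltP; split=> [|i _]; [lra | have [] := Hu i].
have /ereal_sup_gt[_ [r [r0 Hr] <-]] : (m%:E < lebesgue_sup A U)%E.
  by apply: lt_le_trans dU; rewrite lte_fin.
rewrite lte_fin => mr; have [i Hi] := Hr x Ax.
have [_ nUi] := Hu i; apply/nUi/Hi/ballP.
exact: le_lt_trans (Hm i) mr.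
Qed.

Lemma nneg_sup_ge0 (S : set R) : (0 <= nneg_sup S)%E.
Proof. by apply: ereal_sup_ubound; left. Qed.

Lemma nneg_sup_ubound (S : set R) r : S r -> (r%:E <= nneg_sup S)%E.
Proof. by move=> Sr; apply: ereal_sup_ubound; right; exists r. Qed.

Lemma dLip_dist K (f g : lhomeo M) (e : R) x :
  (dLip K f g < e%:E)%E -> K x -> mdist (f x) (g x) < e.
Proof.
move=> fg Kx; rewrite -lte_fin; apply: le_lt_trans fg.
apply: le_trans (leeDl _ (nneg_sup_ge0 _)).
by apply: nneg_sup_ubound; exists x.
Qed.

Lemma dLip_lip K (f g : lhomeo M) (e : R) x y :
  (dLip K f g < e%:E)%E -> K x -> K y ->
  `|mdist (f x) (f y) - mdist (g x) (g y)| <= e * mdist x y.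
Proof.
move=> fg Kx Ky; have [->|nxy] := eqVneq x y.
  by rewrite !mdistxx subrr normr0 mulr0.
have xy0 : 0 < mdist x y by rewrite mdist_gt0.
rewrite -ler_pdivrMr// -[X in _ / X](ger0_norm (ltW xy0)) -normfV -normrM mulrBl.
rewrite -lee_fin; apply: le_trans (ltW fg).
apply: le_trans (leeDr _ (nneg_sup_ge0 _)).
apply: nneg_sup_ubound; exists x, y; split=> //.
exact/eqP.
Qed.

Lemma dLipxx K (f : lhomeo M) : dLip K f f = 0%E.
Proof.
have sup0 (S : set R) : (forall r, S r -> r = 0) -> nneg_sup S = 0%E.
  move=> S0; apply/eqP; rewrite eq_le nneg_sup_ge0 andbT.
  by apply: ge_ereal_sup => _ [->//|[r /S0-> <-]].
rewrite /dLip !sup0 ?adde0//.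
- by move=> r [x [y [_ _ _ ->]]]; rewrite subrr normr0.
- by move=> r [x _ <-]; rewrite mdistxx.
Qed.

End Metric.

(** * Actions and words in the generators *)

Section Action.
Context {R : realType} {M : metricType R} {G : groupType}.
Implicit Types (rho : action M G) (g : G) (x y : M).

Lemma lhomeo_continuous (f : lhomeo M) : continuous f.
Proof. by case: f => f []. Qed.

Lemma lhomeo_inj (f : lhomeo M) : injective f.
Proof. by case: f => f /= [_ [g [_ fg _]] _]; apply: can_inj fg. Qed.

(** The record [action] asks for multiplicativity; [rho 1] is therefore idempotent and, being
    injective, the identity. *)
Lemma act1 rho x : rho 1%g x = x.
Proof. by apply: (@lhomeo_inj (rho 1%g)); rewrite -actM mulg1. Qed.

Lemma actK rho g x : rho g^-1%g (rho g x) = x.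
Proof. by rewrite -actM mulVg act1. Qed.

Lemma actKV rho g x : rho g (rho g^-1%g x) = x.
Proof. by rewrite -actM mulgV act1. Qed.

Lemma invariant_act rho A g x : invariant_set rho A -> A x -> A (rho g x).
Proof. by move=> inv Ax; rewrite -(inv g); exists x. Qed.

Lemma word_length_le (S : set G) g (n : nat) :
  (word_length (R := R) S g < n.+1%:R%:E)%E ->
  exists w : seq G, [/\ (size w <= n)%N, forall s, s \in w -> S s &
    g = (\prod_(s <- w) s)%g].
Proof.
move=> /ereal_inf_lt[_ [w [Sw gw] <-]]; rewrite lte_fin ltr_nat ltnS => wn.
by exists w.
Qed.

Lemma hausdorff_dist_word (S : set G) (A B : set G) (n : nat) a :
  (hausdorff_dist (word_dist (R := R) S) A B <= n%:R%:E)%E -> A a ->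
  exists b, exists2 w : seq G, B b & [/\ (size w <= n)%N,
    forall s, s \in w -> S s & (a^-1 * b)%g = (\prod_(s <- w) s)%g].
Proof.
rewrite ge_max => /andP[H _] Aa.
(* The infimum is at most [n]; an actual word undercuts the strict bound [n.+1], and its length, an
   integer, is then at most [n]. *)
have : (ereal_inf [set word_dist (R := R) S a b | b in B] < n.+1%:R%:E)%E.
  apply: le_lt_trans (_ : (n%:R%:E < _)%E); last by rewrite lte_fin ltr_nat.
  by apply: le_trans H; apply: ereal_sup_ubound; exists a.
move=> /ereal_inf_lt[_ [b Bb <-]] /word_length_le[w Hw].
by exists b, w.
Qed.

End Action.

(** * Codes and shadowing *)

Section CodePoints.
Context {R : realType} {M : metricType R} {G : groupType}.
Implicit Types (rho : action M G) (D : expansion_datum M G).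

(** [code_point] unfolds at the last letter, whereas inductions on codes peel off the first one. *)
Lemma code_pointS rho D (alpha : nat -> ed_index D) x k :
  code_point rho alpha x k.+1 =
  code_point rho (alpha \o S) (rho (ed_gen D (alpha 0%N))^-1%g x) k.
Proof. by elim: k => //= k ->. Qed.

Lemma code_point_ray rho D (alpha : nat -> ed_index D) x k :
  code_point rho alpha x k.+1 = rho (ray_of alpha k)^-1%g x.
Proof.
elim: k => [|k IH]; first by rewrite /ray_of big_nat1.
rewrite -[LHS]/(rho (ed_gen D (alpha k.+1))^-1%g (code_point rho alpha x k.+1)).
by rewrite IH -actM -invgM /ray_of -big_nat_recr.
Qed.

Lemma code_point_in rho D (alpha : nat -> ed_index D) Lambda x k :
  invariant_set rho Lambda -> Lambda x -> Lambda (code_point rho alpha x k).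
Proof. by move=> inv Lx; elim: k => //= k; apply: invariant_act. Qed.

(** The condition at time 0 is included here: tails of codes satisfy it, and the contraction
    estimates then cover the first letter too. *)
Definition strong_code rho D eta x (alpha : nat -> ed_index D) :=
  forall k, ball (code_point rho alpha x k) eta `<=` ed_cover D (alpha k).

Lemma strong_code_is_code rho D eta x (alpha : nat -> ed_index D) :
  strong_code rho eta x alpha -> is_code rho eta x alpha.
Proof. by move=> H k _; apply: H. Qed.

Lemma strong_code_behead rho D eta x (alpha : nat -> ed_index D) :
  is_code rho eta x alpha ->
  strong_code rho eta (rho (ed_gen D (alpha 0%N))^-1%g x) (alpha \o S).
Proof. by move=> H k; rewrite -code_pointS; apply: H. Qed.

Definition cons_code (I : Type) (i : I) (alpha : nat -> I) (k : nat) :=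
  if k is k'.+1 then alpha k' else i.

Lemma cons_code_is_code rho D eta x i (alpha : nat -> ed_index D) :
  strong_code rho eta x alpha ->
  is_code rho eta (rho (ed_gen D i) x) (cons_code i alpha).
Proof. by move=> H [//|k] _; rewrite code_pointS /= actK; apply: H. Qed.

Lemma ray_cons_code0 D i (alpha : nat -> ed_index D) :
  ray_of (cons_code i alpha) 0 = ed_gen D i.
Proof. by rewrite /ray_of big_nat1. Qed.

Lemma ray_cons_codeS D i (alpha : nat -> ed_index D) k :
  ray_of (cons_code i alpha) k.+1 = (ed_gen D i * ray_of alpha k)%g.
Proof. by rewrite /ray_of big_nat_recl. Qed.

Lemma strong_code_exists rho Lambda D x :
  is_expansion_datum rho Lambda D -> Lambda x ->
  exists alpha : nat -> ed_index D, strong_code rho (ed_delta D) x alpha.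
Proof.
move=> [[_ _ inv _] _ [_ _ _ dU] _ _] Lx.
have /choice[i Hi] : forall y : M, exists i, Lambda y ->
    ball y (ed_delta D) `<=` ed_cover D i.
  have [j _] := lebesgue_supP dU Lx.
  move=> y; case: (pselect (Lambda y)) => [Ly|nLy]; last by exists j.
  by have [k Hk] := lebesgue_supP dU Ly; exists k.
pose p k := iter k (fun y => rho (ed_gen D (i y))^-1%g y) x.
have pE k : code_point rho (i \o p) x k = p k by elim: k => //= k ->.
by exists (i \o p) => k; rewrite pE; apply: Hi; rewrite -pE; apply: code_point_in.
Qed.

(** Times run over c_0, c_1, ...: the distance from [x] to [y] itself is not among the bounded
    quantities and is reached by prefixing a generator. *)
Definition shadow rho rho' (r : R) (c : nat -> G) x y :=
  forall k, mdist (rho (c k)^-1%g x) (rho' (c k)^-1%g y) <= r.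

Lemma shadow_le rho rho' r r' c x y :
  r <= r' -> shadow rho rho' r c x y -> shadow rho rho' r' c x y.
Proof. by move=> rr' H k; apply: le_trans rr'; apply: H. Qed.

End CodePoints.

(** The midpoint theta of 1/lambda and 1: a perturbation e <= 1 - theta gives 1/lambda + e <=
    theta. *)
Definition contraction_ratio (R : realType) (M : metricType R) (G : groupType)
    (D : expansion_datum M G) : R := (1 + (ed_lambda D)^-1) / 2.

(* The membership condition uses a fixed scale [b], which makes the codes of
   the perturbed action insensitive to their own scale [eta]. *)
Definition perturbed_datum (R : realType) (M : metricType R) (G : groupType)
    (Lambda : set M) (D : expansion_datum M G)
    (phi : M -> M) (b d : R) : expansion_datum M G :=
  ExpansionDatum
    (fun i => \bigcup_(q in [set q | Lambda q /\ ball q b `<=` ed_cover D i])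
       ball (phi q) (ed_delta D / 8))
    (ed_gen D) d (ed_L D + 1) (contraction_ratio D)^-1.

Section Tracking.
Context {R : realType} {M : metricType R} {G : groupType}.
Context (M_proper : proper_space M).
Context (rho rho' : action M G) (Lambda : set M) (D : expansion_datum M G).
Context (K : set M) (e r : R).
Local Notation s := (ed_gen D).
Local Notation U := (ed_cover D).
Local Notation delta := (ed_delta D).
Local Notation L := (ed_L D).
Local Notation lam := (ed_lambda D).

Local Notation theta := (contraction_ratio D).

Context (HD : is_expansion_datum rho Lambda D).
Context (HK : forall q y, Lambda q -> mdist q y <= (2 * L + 2) * delta -> K y).
Context (Hclose : Hom_nbhd D rho K e rho').
Context (e_gt0 : 0 < e) (e_le : e <= 1 - theta).
Context (er : e <= (1 - theta) * r) (rd : r <= delta / 16).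

Let inv : invariant_set rho Lambda.
Proof. by case: HD => -[]. Qed.

Lemma ed_lambda_gt1 : 1 < lam. Proof. by case: HD => _ _ []. Qed.
Lemma ed_lambda_le_L : lam <= L. Proof. by case: HD => _ _ []. Qed.
Lemma ed_delta_gt0 : 0 < delta. Proof. by case: HD => _ _ []. Qed.

Lemma ed_lambdaV_lt1 : 0 < lam^-1 < 1.
Proof. by have := ed_lambda_gt1 => l1; rewrite invr_gt0 invf_lt1 ?(lt_trans ltr01)// l1. Qed.

Lemma contraction_ratio_lt1 : 0 < theta < 1.
Proof. by have := ed_lambdaV_lt1; rewrite /contraction_ratio; lra. Qed.

Lemma ed_lambdaV_close : lam^-1 + e <= theta.
Proof. by have := e_le; rewrite /contraction_ratio; lra. Qed.

Lemma radius_gt0 : 0 < r.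
Proof.
have t1 := contraction_ratio_lt1; have := lt_le_trans e_gt0 er.
by rewrite pmulr_rgt0//; lra.
Qed.

Lemma error_le_radius : e <= r.
Proof. by have := contraction_ratio_lt1; have := er; have := radius_gt0; nra. Qed.

Let near_in_K q y t : Lambda q -> mdist q y <= t -> t <= 2 * delta -> K y.
Proof.
move=> Lq qy t2; apply: HK Lq _; have := ed_delta_gt0; have := ed_lambda_le_L; have := ed_lambda_gt1.
nra.
Qed.

Lemma cover_index x : Lambda x -> exists i, ball x delta `<=` U i.
Proof. by case: HD => _ _ [_ _ _ dU] _ _ Lx; apply: lebesgue_supP dU Lx. Qed.

(** The ball condition in the definition of expansion places [u] and [v] in the image of the ball
    about [x], where expansion read backwards is contraction. *)
Lemma expanding_inverse i x (eta : R) u v :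
  0 < eta -> eta <= delta -> ball x eta `<=` U i ->
  mdist (rho (s i)^-1%g x) u < lam * eta ->
  mdist (rho (s i)^-1%g x) v < lam * eta ->
  mdist (rho (s i) u) (rho (s i) v) <= lam^-1 * mdist u v.
Proof.
move=> eta0 etad xU /ballP xu /ballP xv.
case: HD => _ _ _ /(_ i)[_ [Hexp Hball]] _.
have [u' u'x u'E] := Hball x eta eta0 etad xU _ xu.
have [v' v'x v'E] := Hball x eta eta0 etad xU _ xv.
have := Hexp _ _ (xU _ u'x) (xU _ v'x).
rewrite u'E v'E -u'E -v'E !actKV => H.
by rewrite ler_pdivlMl ?(lt_trans ltr01 ed_lambda_gt1)// .
Qed.

(** Closeness of the difference quotients on [K] adds at most [e] to the factor 1/lambda. *)
Lemma contract_step i x u v : Lambda x -> ball x delta `<=` U i ->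
  mdist (rho (s i)^-1%g x) u < delta -> mdist (rho (s i)^-1%g x) v < delta ->
  mdist (rho' (s i) u) (rho' (s i) v) <= theta * mdist u v.
Proof.
move=> Lx xU fu fv.
have d0 := ed_delta_gt0; have l1 := ed_lambda_gt1.
have Lfx := invariant_act (s i)^-1%g inv Lx.
have H : mdist (rho (s i) u) (rho (s i) v) <= lam^-1 * mdist u v.
  by apply: expanding_inverse xU _ _ => //; nra.
have Ku : K u by apply: near_in_K Lfx (ltW fu) _; lra.
have Kv : K v by apply: near_in_K Lfx (ltW fv) _; lra.
have := dLip_lip (Hclose i) Ku Kv.
rewrite ler_norml => /andP[H1 H2].
have := ed_lambdaV_close; have := mdist_ge0 u v; nra.
Qed.

Lemma track_step i x u : Lambda x -> ball x delta `<=` U i ->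
  mdist (rho (s i)^-1%g x) u < delta ->
  mdist x (rho' (s i) u) <= e + theta * mdist (rho (s i)^-1%g x) u.
Proof.
move=> Lx xU fu; have d0 := ed_delta_gt0.
have Lfx := invariant_act (s i)^-1%g inv Lx.
have ff : mdist (rho (s i)^-1%g x) (rho (s i)^-1%g x) < delta by rewrite mdistxx.
apply: mdist_le_sum (contract_step Lx xU ff fu).
rewrite -{1}(actKV rho (s i) x); apply/ltW/(dLip_dist (Hclose i)).
by apply: near_in_K Lfx (ltW ff) _; lra.
Qed.

Lemma track_step_lt i x u : Lambda x -> ball x delta `<=` U i ->
  mdist (rho (s i)^-1%g x) u < delta -> mdist x (rho' (s i) u) < delta.
Proof.
move=> Lx xU fu; have := track_step Lx xU fu.
have := contraction_ratio_lt1; have := er; have := rd; have := ed_delta_gt0; nra.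
Qed.

(** The condition [e <= (1 - theta) * r] means e + theta r <= r, so the error bound [r] reproduces
    itself. *)
Lemma track_step_le i x u : Lambda x -> ball x delta `<=` U i ->
  mdist (rho (s i)^-1%g x) u <= r -> mdist x (rho' (s i) u) <= r.
Proof.
move=> Lx xU fu; have d0 := ed_delta_gt0.
have fu' : mdist (rho (s i)^-1%g x) u < delta by have := rd; lra.
have := track_step Lx xU fu'; have := contraction_ratio_lt1; have := er; nra.
Qed.

(** Closeness at the single time [n] suffices: going back letter by letter keeps both points within
    delta of the orbit of [x] and contracts their distance, at most 2 delta at time [n], by theta at
    each letter. *)
Lemma close_orbits_contract n x y z (alpha : nat -> ed_index D) :
  Lambda x -> strong_code rho delta x alpha ->
  mdist (code_point rho alpha x n) (code_point rho' alpha y n) < delta ->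
  mdist (code_point rho alpha x n) (code_point rho' alpha z n) < delta ->
  [/\ mdist y z <= theta ^+ n * (2 * delta), mdist x y < delta &
      mdist x z < delta].
Proof.
elim: n x y z alpha => [|n IH] x y z alpha Lx Hc.
  move=> /= xy xz; split=> //; rewrite expr0 mul1r.
  rewrite metric_sym in xy; have := metric_triangle y x z; lra.
rewrite !code_pointS => py pz.
have Hc0 := Hc 0%N; have Lfx := invariant_act (s (alpha 0%N))^-1%g inv Lx.
have [yz fy fz] := IH _ _ _ _ Lfx (strong_code_behead (strong_code_is_code Hc)) py pz.
split.
- have := contract_step Lx Hc0 fy fz; rewrite !actKV => H.
  by apply: le_trans H _; rewrite exprS -mulrA ler_wpM2l//; have := contraction_ratio_lt1; lra.
- by have := track_step_lt Lx Hc0 fy; rewrite actKV.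
- by have := track_step_lt Lx Hc0 fz; rewrite actKV.
Qed.

Lemma shadow_unique x y z (alpha : nat -> ed_index D) :
  Lambda x -> is_code rho delta x alpha ->
  shadow rho rho' r (ray_of alpha) x y ->
  (forall n, exists2 k, (n <= k)%N &
     mdist (rho (ray_of alpha k)^-1%g x) (rho' (ray_of alpha k)^-1%g z) < delta) ->
  y = z.
Proof.
move=> Lx Hc Hy Hz; set f := rho' (s (alpha 0%N))^-1%g.
have d0 := ed_delta_gt0; have t1 := contraction_ratio_lt1; have rd' := rd.
have Lfx := invariant_act (s (alpha 0%N))^-1%g inv Lx.
(* A code gives no ball at time 0, so the comparison takes place after the first letter; injectivity
   of [f] leads back. *)
suff : mdist (f y) (f z) <= 0.
  move=> H; apply/(@lhomeo_inj _ _ f)/mdist_positivity/eqP.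
  by rewrite eq_le H mdist_ge0.
have yz k : mdist (rho (ray_of alpha k)^-1%g x) (rho' (ray_of alpha k)^-1%g z) < delta ->
    mdist (f y) (f z) <= theta ^+ k * (2 * delta).
  move=> Hk; have Hyk := Hy k; rewrite -!code_point_ray !code_pointS in Hk Hyk.
  have rd0 : r < delta by lra.
  by have [] := close_orbits_contract Lfx (strong_code_behead Hc) (le_lt_trans Hyk rd0) Hk.
apply/ler_addgt0Pr => t t0; rewrite add0r.
have [n Hn] := geometric_small (2 * delta) t1 t0.
have [k nk Hk] := Hz n.
exact: le_trans (yz k Hk) (ltW (Hn k nk)).
Qed.

(** The point is built from the end: start at the last orbit point of [x] and apply the generators
    under [rho'] backwards. *)
Lemma finite_shadow n x (alpha : nat -> ed_index D) :
  Lambda x -> strong_code rho delta x alpha ->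
  exists y, forall k, (k <= n)%N ->
    mdist (code_point rho alpha x k) (code_point rho' alpha y k) <= r.
Proof.
elim: n x alpha => [|n IH] x alpha Lx Hc.
  by exists x => k; rewrite leqn0 => /eqP->; rewrite mdistxx; apply: ltW radius_gt0.
have Hc0 := Hc 0%N; have Lfx := invariant_act (s (alpha 0%N))^-1%g inv Lx.
have [y Hy] := IH _ _ Lfx (strong_code_behead (strong_code_is_code Hc)).
exists (rho' (s (alpha 0%N)) y) => -[_|k kn].
  exact: track_step_le Lx Hc0 (Hy 0%N _).
by rewrite !code_pointS actK; apply: Hy.
Qed.

Lemma code_point_continuous (alpha : nat -> ed_index D) k :
  continuous (fun y => code_point rho' alpha y k).
Proof.
elim: k => [|k IH] y /=; first by apply: cvg_id.
exact: (continuous_comp (IH y) (@lhomeo_continuous _ _ (rho' (s (alpha k))^-1%g) _)).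
Qed.

(** By properness the finite shadowing points cluster; the condition at time [k] is closed and holds
    for all n >= k. *)
Lemma strong_shadow x (alpha : nat -> ed_index D) :
  Lambda x -> strong_code rho delta x alpha ->
  exists y, forall k,
    mdist (code_point rho alpha x k) (code_point rho' alpha y k) <= r.
Proof.
move=> Lx Hc.
have [u Hu] := choice (fun n => finite_shadow n Lx Hc).
have Bc : compact [set y | mdist x y <= r] by apply: M_proper.
have [|p [_ up]] := Bc (u @ \oo) _.
  by exists 0%N => // n _; apply: (Hu n 0%N).
exists p => k; apply: (cluster_mdist_le (@code_point_continuous alpha k) up).
by exists k => // n /= kn; apply: Hu.
Qed.

Lemma shadow_exists x c : Lambda x -> Ray rho D delta x c ->
  exists y, shadow rho rho' r c x y.
Proof.
move=> Lx [alpha Hc <-].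
have Lfx := invariant_act (s (alpha 0%N))^-1%g inv Lx.
have [y Hy] := strong_shadow Lfx (strong_code_behead Hc).
exists (rho' (s (alpha 0%N)) y) => k.
by rewrite -!code_point_ray !code_pointS actK.
Qed.

(** * Comparison of rays through words *)

Lemma gen_inverse j : exists i, s j = (s i)^-1%g.
Proof.
case: HD => _ _ _ _ [sym _].
have [i _ Hi] : ed_Sigma D (s j)^-1%g by apply: sym; exists j.
by exists i; rewrite Hi invgK.
Qed.

Lemma close_inverse i : (dLip K (rho (s i)^-1%g) (rho' (s i)^-1%g) < e%:E)%E.
Proof.
case: HD => _ _ _ _ [sym _].
have [j _ <-] : ed_Sigma D (s i)^-1%g by apply: sym; exists i.
exact: Hclose.
Qed.

Lemma mdist_lt_nbhd q u (t : R) : Lambda q -> mdist q u < t -> nbhd Lambda t u.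
Proof. by move=> Lq qu; exists q => //; apply/ballP. Qed.

Lemma gen_close p u j : Lambda p -> mdist p u < delta ->
  mdist (rho (s j) p) (rho' (s j) u) <= L * mdist p u + e.
Proof.
move=> Lp pu; have d0 := ed_delta_gt0.
have Ku : K u by apply: near_in_K Lp (ltW pu) _; lra.
apply: mdist_le_sum (ltW (dLip_dist (Hclose j) Ku)).
have [i ->] := gen_inverse j.
case: HD => _ _ _ /(_ i)[Hlip _] _; apply: Hlip; last exact: mdist_lt_nbhd pu.
by apply: mdist_lt_nbhd Lp _; rewrite mdistxx.
Qed.

(** A letter turns an error a >= r into at most L a + e <= (L + 1) a; the bound by delta keeps every
    intermediate point where the Lipschitz estimate holds. *)
Lemma word_close p u (w : seq G) : Lambda p -> mdist p u <= r ->
  (forall g, g \in w -> ed_Sigma D g) -> r * (L + 1) ^+ size w < delta ->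
  mdist (rho (\prod_(g <- w) g)%g p) (rho' (\prod_(g <- w) g)%g u) <=
  r * (L + 1) ^+ size w.
Proof.
move=> Lp pu; elim: w => [_ _|g w IH Sw].
  by rewrite big_nil !act1 expr0 mulr1.
have [j _ jg] : ed_Sigma D g by apply: Sw; rewrite mem_head.
have L1 : 1 <= L + 1 by have := ed_lambda_le_L; have := ed_lambda_gt1; lra.
have r0 := radius_gt0; set E := (L + 1) ^+ size w.
have E1 : 1 <= E by apply: exprn_ege1.
rewrite /= exprS -/E => wd.
have Ed : r * E < delta by apply: le_lt_trans wd; rewrite mulrCA ler_peMl//; nra.
have IHw := IH (fun h hw => Sw h (mem_behead (s := g :: w) hw)) Ed.
rewrite big_cons !actM -jg.
have Lwp := invariant_act (\prod_(h <- w) h)%g inv Lp.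
have := gen_close j Lwp (le_lt_trans IHw Ed).
have := error_le_radius; have : r <= r * E by rewrite ler_peMr// ltW.
have : L * mdist (rho (\prod_(h <- w) h)%g p) (rho' (\prod_(h <- w) h)%g u) <= L * (r * E).
  by rewrite ler_wpM2l//; lra.
lra.
Qed.

Context (N : nat) (rN : r * (L + 1) ^+ N < delta).

Lemma ray_approx_shadow x c c' y z : Lambda x ->
  ray_approx rho D delta N x c c' ->
  shadow rho rho' r c x y -> shadow rho rho' r c' x z -> y = z.
Proof.
move=> Lx [[alpha Hc <-] _ [P [Q [Pinf _ PQ]]]] Hy Hz.
apply: (shadow_unique Lx Hc Hy) => n.
have [k Pk nk] : exists2 k, P k & (n <= k)%N.
  apply: contrapT => H; apply: Pinf; apply: sub_finite_set (finite_II n).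
  by move=> k Pk /=; rewrite ltnNge; apply/negP => nk; apply: H; exists k.
exists k => //.
have [|_ [w [j _ <-] [wN Sw ww]]] := hausdorff_dist_word PQ (a := ray_of alpha k).
  by exists k.
(* By this identity the orbit points at time [k] of the first ray are the images under [w] of those
   at time [j] of [c'], which are within [r] of each other. *)
have cE : ((ray_of alpha k)^-1 = \prod_(g <- w) g * (c' j)^-1)%g.
  by rewrite -ww mulgK.
rewrite cE !actM.
have L1 : 1 <= L + 1 by have := ed_lambda_le_L; have := ed_lambda_gt1; lra.
have wd : r * (L + 1) ^+ size w < delta.
  apply: le_lt_trans rN; rewrite ler_wpM2l ?(ltW radius_gt0)//.
  exact: ler_weXn2l.
by apply: le_lt_trans (wd); apply: word_close => //; apply: invariant_act.
Qed.

(** Ray membership is carried through the induction because [clos_refl_sym_trans] does not record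
    that intermediate sequences are rays. *)
Lemma ray_equiv_shadow x c c' y : Lambda x ->
  ray_equiv rho D delta N x c c' ->
  shadow rho rho' r c x y -> shadow rho rho' r c' x y.
Proof.
move=> Lx [Rc _ cc']; suff [_ H] : (Ray rho D delta x c <-> Ray rho D delta x c') /\
    (Ray rho D delta x c -> forall y,
      shadow rho rho' r c x y <-> shadow rho rho' r c' x y) by apply H.
elim: cc' {y Rc} => {c c'}[c c' cc'|//|c c' _ [R1 S1]|c1 c2 c3 _ [R1 S1] _ [R2 S2]].
- case: (cc') => Rc Rc' _; split=> // _ y.
  (* Each ray has a shadowing point, so equality of shadowing points transfers shadowing from one
     ray to the other. *)
  have [z Hz] := shadow_exists Lx Rc; have [z' Hz'] := shadow_exists Lx Rc'.
  by split=> Hy; [rewrite (ray_approx_shadow Lx cc' Hy Hz')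
                 |rewrite -(ray_approx_shadow Lx cc' Hz Hy)].
- by split=> [|Rc' y]; [split=> /R1|rewrite S1//; apply/R1].
- split=> [|Rc y]; first by rewrite R1.
  by rewrite S1// S2//; apply/R1.
Qed.

(** * Moduli of continuity of the conjugacy and its inverse *)

Section Conjugacy.
Context (phi : M -> M).
Context (phiE : forall g x, Lambda x -> rho' g (phi x) = phi (rho g x)).
Context (phiC : forall x, Lambda x -> mdist x (phi x) <= r).

(** An inverse generator expanding at [x] moves the pair to where the bound for [n] applies;
    equivariance and the contraction by [rho' (s i)] gain one factor theta. *)
Lemma conjugacy_modulus n x : Lambda x -> exists2 d : R, 0 < d &
  forall y, Lambda y -> mdist x y < d -> mdist (phi x) (phi y) <= theta ^+ n * delta.
Proof.
have d0 := ed_delta_gt0; have rd' := rd; have t1 := contraction_ratio_lt1.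
elim: n x => [|n IH] x Lx.
  exists (delta / 2) => [|y Ly xy]; first lra.
  have := phiC Lx; rewrite metric_sym => px; have := phiC Ly => py.
  have := metric_triangle (phi x) x (phi y); have := metric_triangle x y (phi y).
  by rewrite expr0 mul1r; lra.
have [i xU] := cover_index Lx.
have Lfx := invariant_act (s i)^-1%g inv Lx.
have [d1 d10 H1] := IH _ Lfx.
(* The bound [delta / 2] keeps [phi] of the image of [y] within delta, as the contraction
   requires. *)
have m0 : 0 < Num.min d1 (delta / 2) by rewrite lt_min d10 /=; lra.
have [d dgt0 Hd] := continuous_mdistP x (@lhomeo_continuous _ _ (rho (s i)^-1%g)) m0.
exists d => // y Ly /Hd; rewrite lt_min => /andP[f1 f2].
have Lfy := invariant_act (s i)^-1%g inv Ly.
rewrite -(actKV rho' (s i) (phi x)) -(actKV rho' (s i) (phi y)).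
rewrite (phiE (s i)^-1%g Lx) (phiE (s i)^-1%g Ly).
have px := phiC Lfx; have py := phiC Lfy.
apply: le_trans (contract_step Lx xU _ _) _; first by lra.
  by have := metric_triangle (rho (s i)^-1%g x) (rho (s i)^-1%g y) (phi (rho (s i)^-1%g y)); lra.
by rewrite exprS -mulrA ler_wpM2l//; [lra | apply: H1].
Qed.

(** Here the gain of 1/lambda per step comes from the expansion of [rho] itself, while closeness of
    the image points is propagated by [rho']. *)
Lemma conjugacy_inv_modulus n x : Lambda x -> exists2 d : R, 0 < d &
  forall y, Lambda y -> mdist (phi x) (phi y) < d -> mdist x y <= lam^-1 ^+ n * delta.
Proof.
have d0 := ed_delta_gt0; have rd' := rd; have l1 := ed_lambdaV_lt1; have l2 := ed_lambda_gt1.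
have near x' y' : Lambda x' -> Lambda y' -> mdist (phi x') (phi y') < delta / 2 ->
    mdist x' y' < delta.
  move=> Lx Ly xy; have := phiC Lx => px; have := phiC Ly; rewrite metric_sym => py.
  have := metric_triangle x' (phi x') y'; have := metric_triangle (phi x') (phi y') y'.
  lra.
elim: n x => [|n IH] x Lx.
  exists (delta / 2) => [|y Ly xy]; first lra.
  by rewrite expr0 mul1r; apply/ltW/near.
have [i xU] := cover_index Lx.
have Lfx := invariant_act (s i)^-1%g inv Lx.
have [d1 d10 H1] := IH _ Lfx.
have [d dgt0 Hd] := continuous_mdistP (phi x) (@lhomeo_continuous _ _ (rho' (s i)^-1%g)) d10.
exists (Num.min d (delta / 2)) => [|y Ly]; first by rewrite lt_min dgt0 /=; lra.
rewrite lt_min => /andP[/Hd + f2]; rewrite !phiE// => f1.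
have Lfy := invariant_act (s i)^-1%g inv Ly.
have Uy : U i y by apply/xU/ballP/near.
have Ux : U i x by apply/xU/ballP; rewrite mdistxx.
have [_ _ _ /(_ i)[_ [Hexp _]] _] := HD.
rewrite exprS -mulrA ler_pdivlMl ?(lt_trans ltr01)//.
exact: le_trans (Hexp _ _ Ux Uy) (H1 _ Lfy f1).
Qed.

Lemma conjugacy_continuous : {within Lambda, continuous phi}.
Proof.
apply: within_continuous_mdist => x t Lx t0.
have [n Hn] := geometric_small delta contraction_ratio_lt1 t0.
have [d d0 Hd] := conjugacy_modulus n Lx.
by exists d => // y Ly xy; apply: le_lt_trans (Hd y Ly xy) (Hn n (leqnn n)).
Qed.

Lemma conjugacy_compact : compact (phi @` Lambda).
Proof.
by apply: continuous_compact conjugacy_continuous _; case: HD => -[].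
Qed.

Lemma conjugacy_inj x y : Lambda x -> Lambda y -> phi x = phi y -> x = y.
Proof.
move=> Lx Ly xy; apply: mdist_positivity; apply/eqP.
rewrite eq_le mdist_ge0 andbT; apply/ler_addgt0Pr => t t0; rewrite add0r.
have [n Hn] := geometric_small delta ed_lambdaV_lt1 t0.
have [d d0 Hd] := conjugacy_inv_modulus n Lx.
by apply: le_trans (Hd y Ly _) (ltW (Hn n (leqnn n))); rewrite xy mdistxx.
Qed.

Lemma conjugacy_homeo : homeo_onto Lambda (phi @` Lambda) phi.
Proof.
split=> //; first exact: conjugacy_continuous.
have /choice[g Hg] : forall y, exists x, (phi @` Lambda) y -> Lambda x /\ phi x = y.
  move=> y; case: (pselect ((phi @` Lambda) y)) => [[x Lx xy]|nLy].
    by exists x.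
  by exists y.
have gK x : Lambda x -> g (phi x) = x.
  move=> Lx; have [|Lg gE] := Hg (phi x); first by exists x.
  exact: conjugacy_inj.
exists g => //; apply: within_continuous_mdist => _ t [x Lx <-] t0.
have [n Hn] := geometric_small delta ed_lambdaV_lt1 t0.
have [d d0 Hd] := conjugacy_inv_modulus n Lx.
exists d => // _ [y Ly <-] xy; rewrite !gK//.
exact: le_lt_trans (Hd y Ly xy) (Hn n (leqnn n)).
Qed.

Lemma conjugacy_invariant : invariant_set rho' (phi @` Lambda).
Proof.
move=> g; apply/seteqP; split=> [_ [_ [x Lx <-] <-]|_ [x Lx <-]].
  by rewrite phiE//; exists (rho g x) => //; apply: invariant_act.
exists (phi (rho g^-1%g x)); last by rewrite -phiE// actKV.
by exists (rho g^-1%g x) => //; apply: invariant_act.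
Qed.

(** [theta^-1] is the harmonic mean of 1 and lambda, hence at most (1 + lambda) / 2, and e <= (1 -
    1/lambda) / 2 <= (lambda - 1) / 2. *)
Lemma contraction_ratioV : 1 < theta^-1 /\ theta^-1 + e <= lam.
Proof.
have t1 := contraction_ratio_lt1; have l1 := ed_lambdaV_lt1; have l2 := ed_lambda_gt1.
split; first by rewrite invf_gt1; lra.
suff : theta^-1 <= (1 + lam) / 2.
  have : lam * lam^-1 = 1 by rewrite mulfV// gt_eqF// (lt_trans ltr01).
  by have := e_le; rewrite {1}/contraction_ratio; nra.
rewrite -[leRHS]invrK lef_pV2 ?posrE; try lra; last first.
  by rewrite invr_gt0; lra.
rewrite invf_div ler_pdivrMr; last lra.
have : lam * lam^-1 = 1 by rewrite mulfV// gt_eqF// (lt_trans ltr01).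
rewrite /contraction_ratio; nra.
Qed.

(** * Expansion data of the perturbed action *)

Context (geo : geodesic_space M) (b d : R).
Context (b_ge : delta / 2 <= b) (b_le : b <= delta).
Context (d_gt0 : 0 < d) (d_le : d <= delta / 8).
Local Notation D' := (perturbed_datum Lambda D phi b d).

(** The distance from [q] to [u] is below r + delta/8 <= 3 delta/16, which leaves more than delta/4
    of the radius b >= delta/2. *)
Lemma perturbed_coverP i u : ed_cover D' i u ->
  exists q, [/\ Lambda q, mdist q u < delta / 4 & ball u (delta / 4) `<=` U i].
Proof.
have rd' := rd; have d0 := ed_delta_gt0.
move=> [q [Lq qU] /ballP qu]; exists q.
have := metric_triangle q (phi q) u; have := phiC Lq => pq qu'.
split=> //; first lra.
move=> v /ballP uv; apply/qU/ballP.
by have := metric_triangle q u v; have := b_ge; lra.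
Qed.

Lemma gen_lipschitz i q u v : Lambda q -> mdist q u < delta -> nbhd Lambda delta v ->
  mdist (rho (s i)^-1%g u) (rho (s i)^-1%g v) <= L * mdist u v.
Proof.
move=> Lq qu vL; have [_ _ _ /(_ i)[Hlip _] _] := HD.
by apply: Hlip => //; exact: mdist_lt_nbhd qu.
Qed.

Lemma perturbed_expanding i :
  expanding_on_upto theta^-1 (ed_cover D' i) d (rho' (s i)^-1%g).
Proof.
have rd' := rd; have d0 := ed_delta_gt0; have t1 := contraction_ratio_lt1.
have [tV tVe] := contraction_ratioV; have e0 := e_gt0; have er' := error_le_radius.
have dl := d_le; have l1 := ed_lambda_gt1; have lL := ed_lambda_le_L.
split=> [u v Uu Uv|x eta eta0 etad xU y /ballP xy].
  have [q [Lq qu uU]] := perturbed_coverP Uu.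
  have [q' [Lq' qv vU]] := perturbed_coverP Uv.
  have Ku : K u by apply: near_in_K Lq (ltW qu) _; lra.
  have Kv : K v by apply: near_in_K Lq' (ltW qv) _; lra.
  have := dLip_lip (close_inverse i) Ku Kv.
  rewrite ler_norml => /andP[H1 H2].
  have [_ _ _ /(_ i)[_ [Hexp _]] _] := HD.
  have Uu' : U i u by apply/uU/ballP; rewrite mdistxx; lra.
  have Uv' : U i v by apply/vU/ballP; rewrite mdistxx; lra.
  have := Hexp u v Uu' Uv'; have := mdist_ge0 u v; nra.
have xU' : ed_cover D' i x by apply/xU/ballP; rewrite mdistxx.
have [q [Lq qx xUi]] := perturbed_coverP xU'.
have Kx : K x by apply: near_in_K Lq (ltW qx) _; lra.
have fx := dLip_dist (close_inverse i) Kx.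
set fx0 := rho (s i)^-1%g x in fx *; set fx1 := rho' (s i)^-1%g x in fx xy *.
have fy : mdist fx0 y < lam * (delta / 4).
  have : theta^-1 * eta <= lam * (delta / 8) by apply: ler_pM; lra.
  have := metric_triangle fx0 fx1 y; nra.
have fx' : mdist fx0 fx1 < lam * (delta / 4) by nra.
have Lfq := invariant_act (s i)^-1%g inv Lq.
have fqx : mdist (rho (s i)^-1%g q) fx0 <= L * (delta / 4).
  have qd : mdist q x < delta by lra.
  apply: le_trans (gen_lipschitz i Lq _ (mdist_lt_nbhd Lq qd)) _.
    by rewrite mdistxx.
  by rewrite ler_wpM2l ?ltW//; lra.
have lLd : lam * (delta / 4) <= L * (delta / 4) by rewrite ler_wpM2r//; lra.
have Ld : 0 < L * delta by rewrite mulr_gt0//; lra.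
(* [x] need not lie in [Lambda], so [y] is reached from the image of [q] through the Lipschitz
   bound; hence the factor L in the radius of [K]. *)
have Ky : K y.
  apply: HK Lfq _; have := metric_triangle (rho (s i)^-1%g q) fx0 y; lra.
have Kfx : K fx1.
  apply: HK Lfq _; have := metric_triangle (rho (s i)^-1%g q) fx0 fx1; lra.
have d4 : 0 < delta / 4 by lra.
have d4' : delta / 4 <= delta by lra.
have H := expanding_inverse d4 d4' xUi fx' fy.
have := dLip_lip (Hclose i) Kfx Ky.
rewrite ler_norml => /andP[H1 H2].
(* The contraction by theta under [rho' (s i)] brings this preimage within [eta] of [x]. *)
exists (rho' (s i) y); last exact: actK.
apply/ballP; rewrite -(actKV rho' (s i) x) -/fx1.
apply: (@le_lt_trans _ _ (theta * mdist fx1 y)).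
  by have := ed_lambdaV_close; have := mdist_ge0 fx1 y; nra.
rewrite -ltr_pdivlMl// ; lra.
Qed.

Lemma perturbed_expansion_datum : is_expansion_datum rho' (phi @` Lambda) D'.
Proof.
have rd' := rd; have d0 := ed_delta_gt0; have [tV tVe] := contraction_ratioV.
have e0 := e_gt0; have dl := d_le; have l1 := ed_lambda_gt1; have lL := ed_lambda_le_L.
have bl := b_le.
have D'_cover x : Lambda x -> exists i, ball (phi x) (delta / 8) `<=` ed_cover D' i.
  move=> Lx; have [i xU] := cover_index Lx; exists i => y xy; exists x => //.
  by split=> // z /ballP xz; apply/xU/ballP; lra.
have [[[x0 Lx0] Lc _ Liso] _ _ Hgen [sym gen]] := HD.
split=> //=.
- split; [by exists (phi x0), x0|exact: conjugacy_compact|exact: conjugacy_invariant|].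
  (* Non-isolation of one point of [Lambda] yields two distinct points of [M]; geodesicity then
     excludes isolated points everywhere. *)
  move=> z _; have [x [y xy]] : exists x y : M, x != y.
    apply: contrapT => H; apply: (Liso _ Lx0); split; first exact/mem_set.
    exists setT; first exact: filterT.
    rewrite setIT; apply/seteqP; split=> // y _ /=.
    by apply: contrapT => /eqP nyx; apply: H; exists y, x0.
  exact: geodesic_not_isolated geo xy.
- split=> [i|_ [x Lx <-]].
    by apply: bigcup_open => q _; apply: open_mball.
  have [i Hi] := D'_cover x Lx; exists i => //; apply/Hi/ballP.
  by rewrite mdistxx; lra.
- split=> //; first by lra.
  apply: ereal_sup_ubound; exists d => //; split=> // _ [x Lx <-].
  have [i Hi] := D'_cover x Lx; exists i => y /ballP xy; apply/Hi/ballP; lra.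
- move=> i; split; last exact: perturbed_expanding.
  have near u : nbhd (phi @` Lambda) d u -> exists2 q, Lambda q & mdist q u < delta.
    move=> [_ [q Lq <-] /ballP qu]; exists q => //.
    by have := phiC Lq; have := metric_triangle q (phi q) u; lra.
  move=> u v /near[q Lq qu] /near[q' Lq' qv].
  have Ku : K u by apply: near_in_K Lq (ltW qu) _; lra.
  have Kv : K v by apply: near_in_K Lq' (ltW qv) _; lra.
  have := dLip_lip (close_inverse i) Ku Kv.
  rewrite ler_norml => /andP[H1 H2].
  have := gen_lipschitz i Lq qu (mdist_lt_nbhd Lq' qv).
  have t1 := contraction_ratio_lt1; have e1 := e_le; have := mdist_ge0 u v; nra.
Qed.

Lemma code_point_conjugacy (alpha : nat -> ed_index D) x k : Lambda x ->
  code_point rho' (D := D') alpha (phi x) k = phi (code_point rho alpha x k).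
Proof.
move=> Lx; elim: k => //= k ->; rewrite phiE//.
exact: code_point_in.
Qed.

Lemma is_code_perturbed (alpha : nat -> ed_index D) eta x : Lambda x -> eta <= d ->
  is_code rho b x alpha -> is_code rho' (D := D') eta (phi x) alpha.
Proof.
move=> Lx etad Hc k k0; rewrite code_point_conjugacy// => y /ballP py.
exists (code_point rho alpha x k); last by apply/ballP; have := d_le; lra.
by split; [exact: code_point_in | exact: Hc].
Qed.

(** Each orbit point of [x] lies within delta/8 + 2 r <= delta/4 of some center [q], a loss
    independent of [eta]. *)
Lemma is_code_of_perturbed (alpha : nat -> ed_index D) eta x : Lambda x -> 0 < eta ->
  is_code rho' (D := D') eta (phi x) alpha -> is_code rho (b - delta / 4) x alpha.
Proof.
move=> Lx eta0 Hc k k0 y /ballP py.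
have Lp := code_point_in alpha k inv Lx.
have [|q [Lq qU] /ballP] := Hc k k0 (phi (code_point rho alpha x k)).
  by rewrite code_point_conjugacy//; apply/ballP; rewrite mdistxx.
set p := code_point rho alpha x k in py Lp * => qp.
apply/qU/ballP.
have := phiC Lq; have := phiC Lp; rewrite [mdist p _]metric_sym => pp qq.
have := metric_triangle q (phi q) y; have := metric_triangle (phi q) (phi p) y.
by have := metric_triangle (phi p) p y; have := rd; lra.
Qed.

End Conjugacy.

End Tracking.

(** * Structural stability *)

Section Stability.
Context {R : realType} {M : metricType R} {G : groupType}.
Implicit Types (rho : action M G) (D : expansion_datum M G) (Lambda K : set M).

Lemma Hom_nbhd_nbhs rho D K (e : R) : compact K -> 0 < e ->
  nbhs (rho : hom_space D) (Hom_nbhd D rho K e : set (hom_space D)).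
Proof.
move=> Kc e0; pose V i := [set g : lhomeo M | (dLip K (rho (ed_gen D i)) g < e%:E)%E].
suff nbV : forall i, nbhs (rho : hom_space D) [set rho' : hom_space D | V i (hom_gens D rho' i)].
  exact: (@filter_forall (hom_space D) _ _ _ _ nbV).
move=> i; have nV : nbhs (proj i (hom_gens D rho)) (V i).
  apply: open_nbhs_nbhs; split; last by rewrite /V /= dLipxx lte_fin.
  exists [set V i]; last by rewrite bigcup_set1.
  move=> _ ->; exists [fset V i]%fset => [W|].
    rewrite !inE => /eqP ->; apply/mem_set.
    by exists (rho (ed_gen D i)), K, e.
  by rewrite set_fset1 bigcap_set1.
have npV := @proj_continuous _ (fun _ : ed_index D => lhomeo M) i (hom_gens D rho) _ nV.
exact: (@initial_continuous _ _ (hom_gens D) rho _ npV).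
Qed.

(** The minimum with 1 bounds [stability_eps] by 1 - theta; the denominator makes both r and r (L +
    1)^N at most delta/16. *)
Definition stability_radius D (N : nat) : R :=
  Num.min 1 (ed_delta D / (16 * (ed_L D + 1) ^+ N)).

Definition stability_eps D (N : nat) : R :=
  (1 - contraction_ratio D) * stability_radius D N.

Lemma stability_epsP rho Lambda D N (r := stability_radius D N)
    (e := stability_eps D N) : is_expansion_datum rho Lambda D ->
  [/\ 0 < e, e <= 1 - contraction_ratio D, e <= (1 - contraction_ratio D) * r,
      r <= ed_delta D / 16 & r * (ed_L D + 1) ^+ N < ed_delta D].
Proof.
move=> HD; have t1 := contraction_ratio_lt1 HD; have d0 := ed_delta_gt0 HD.
have L1 : 1 <= ed_L D + 1 by have := ed_lambda_le_L HD; have := ed_lambda_gt1 HD; lra.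
have E1 : 1 <= (ed_L D + 1) ^+ N by apply: exprn_ege1.
rewrite /e /stability_eps -/r; set E := (ed_L D + 1) ^+ N in E1 *.
have E16 : 0 < 16 * E by lra.
have r0 : 0 < r by rewrite lt_min ltr01 divr_gt0.
have r1 : r <= 1 by rewrite ge_min lexx.
have rE : r * E <= ed_delta D / 16.
  have : r <= ed_delta D / (16 * E) by rewrite ge_min lexx orbT.
  by rewrite ler_pdivlMr//; lra.
split=> //; try lra.
- by rewrite mulr_gt0//; lra.
- by rewrite ler_piMr//; lra.
- by apply: le_trans rE; rewrite ler_peMr// ltW.
Qed.

(** The second clause is for continuity at [rho]: [phi] stays the same, while smaller [e'] and [r']
    sharpen its distance to the identity. *)
Lemma conjugacy_exists rho rho' Lambda D0 D N K (r := stability_radius D N) :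
  proper_space M -> meandering_hyperbolic_with rho Lambda D0 D N ->
  (forall q y, Lambda q -> mdist q y <= (2 * ed_L D + 2) * ed_delta D -> K y) ->
  Hom_nbhd D rho K (stability_eps D N) rho' ->
  exists phi : M -> M,
    (forall g x, Lambda x -> rho' g (phi x) = phi (rho g x)) /\
    forall e' r', 0 < e' -> e' <= 1 - contraction_ratio D ->
      e' <= (1 - contraction_ratio D) * r' -> r' <= r -> Hom_nbhd D rho K e' rho' ->
      forall x, Lambda x -> mdist x (phi x) <= r'.
Proof.
move=> M_proper [HD0 HD _ _ Hrays] HK Hclose.
have := stability_epsP N HD; rewrite -/r => -[e0 e1 er rd rN].
have [[[x0 Lx0] _ inv _] _ _ _ [_ gen0]] := HD0.
have L1 : 0 <= (ed_L D + 1) ^+ N.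
  by rewrite exprn_ge0//; have := ed_lambda_le_L HD; have := ed_lambda_gt1 HD; lra.
have ray_D x c : Lambda x -> Ray rho D0 (ed_delta D0) x c -> Ray rho D (ed_delta D) x c.
  by move=> Lx Rc; have [] := Hrays x Lx c c Rc Rc.
have common e' r' x c0 : 0 < e' -> e' <= 1 - contraction_ratio D ->
    e' <= (1 - contraction_ratio D) * r' -> r' <= r -> Hom_nbhd D rho K e' rho' ->
    Lambda x -> Ray rho D0 (ed_delta D0) x c0 ->
    exists y, forall c, Ray rho D0 (ed_delta D0) x c -> shadow rho rho' r' c x y.
  move=> e'0 e'1 e'r r'r Hcl Lx R0.
  have r'd := le_trans r'r rd.
  have r'N : r' * (ed_L D + 1) ^+ N < ed_delta D.
    by apply: le_lt_trans rN; rewrite ler_wpM2r.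
  have [y Hy] := shadow_exists M_proper HD HK Hcl e'0 e'1 e'r r'd Lx (ray_D _ _ Lx R0).
  exists y => c Rc.
  exact: (ray_equiv_shadow M_proper HD HK Hcl e'0 e'1 e'r r'd r'N Lx (Hrays x Lx c0 c R0 Rc) Hy).
have unique x c y z : Lambda x -> Ray rho D0 (ed_delta D0) x c ->
    shadow rho rho' r c x y -> shadow rho rho' r c x z -> y = z.
  move=> Lx /(ray_D _ _ Lx)[alpha Hc <-] Hy Hz.
  apply: (shadow_unique HD HK Hclose e1 er rd Lx Hc Hy) => n; exists n => //.
  by apply: le_lt_trans (Hz n) _; have := ed_delta_gt0 HD; lra.
have /choice[phi Hphi] : forall x, exists y, Lambda x ->
    forall c, Ray rho D0 (ed_delta D0) x c -> shadow rho rho' r c x y.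
  move=> x; case: (pselect (Lambda x)) => [Lx|nLx]; last by exists x.
  have [alpha Hc] := strong_code_exists HD0 Lx.
  have [|y Hy] := common _ r x (ray_of alpha) e0 e1 er (lexx r) Hclose Lx.
    by exists alpha => //; apply: strong_code_is_code.
  by exists y.
(* Prefixing the generator to a code of [x] gives a ray of its image; deleting the first letter
   compares the shadowing points of the two. *)
have step e' r' i x : 0 < e' -> e' <= 1 - contraction_ratio D ->
    e' <= (1 - contraction_ratio D) * r' -> r' <= r -> Hom_nbhd D rho K e' rho' ->
    Lambda x -> rho' (ed_gen D0 i)^-1%g (phi (rho (ed_gen D0 i) x)) = phi x /\
      mdist x (phi x) <= r'.
  move=> e'0 e'1 e'r r'r Hcl Lx; set g := ed_gen D0 i.
  have Lgx := invariant_act g inv Lx.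
  have [alpha Hc] := strong_code_exists HD0 Lx.
  have Rc : Ray rho D0 (ed_delta D0) x (ray_of alpha).
    by exists alpha => //; apply: strong_code_is_code.
  have Rgc : Ray rho D0 (ed_delta D0) (rho g x) (ray_of (cons_code i alpha)).
    by exists (cons_code i alpha) => //; apply: cons_code_is_code.
  have [y Hy] := common _ _ _ _ e'0 e'1 e'r r'r Hcl Lgx Rgc.
  have yE : phi (rho g x) = y.
    exact: (unique _ _ _ _ Lgx Rgc (Hphi _ Lgx _ Rgc) (shadow_le r'r (Hy _ Rgc))).
  have Sh : shadow rho rho' r' (ray_of alpha) x (rho' g^-1%g y).
    move=> k; have := Hy _ Rgc k.+1.
    by rewrite ray_cons_codeS invgM !actM actK.
  have E : rho' g^-1%g y = phi x.
    exact: (unique _ _ _ _ Lx Rc (shadow_le r'r Sh) (Hphi _ Lx _ Rc)).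
  split; first by rewrite yE.
  (* The prefixed ray starts with the generator, so its time 0 compares [x] with [phi x]. *)
  by have := Hy _ Rgc 0%N; rewrite ray_cons_code0 actK E.
exists phi; split.
  pose H := [set g | forall x, Lambda x -> rho' g (phi x) = phi (rho g x)].
  apply: (gen0 H) => [x Lx|g h Hg Hh x Lx|_ [i _ <-] x Lx].
  - by rewrite !act1.
  - rewrite !actM -Hg; last exact: invariant_act.
    congr (rho' g _); apply: (@lhomeo_inj _ _ (rho' h)).
    by rewrite actKV Hh ?actKV//; apply: invariant_act.
  - have [<- _] := step _ _ i x e0 e1 er (lexx r) Hclose Lx.
    by rewrite actKV.
move=> e' r' e'0 e'1 e'r r'r Hcl x Lx.
(* Any letter serves as prefix; the cover at [x0] supplies one. *)
have [i _] := cover_index HD0 Lx0.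
by have [] := step e' r' i x e'0 e'1 e'r r'r Hcl Lx.
Qed.

(* [D0] with the constants of its refinement [D], so that one perturbation
   statement covers both data with an [eps] depending on [D] only. *)
Definition weakened_datum D0 D : expansion_datum M G :=
  ExpansionDatum (ed_cover D0) (ed_gen D0) (ed_delta D) (ed_L D) (ed_lambda D).

Lemma weakened_expansion_datum rho Lambda D0 D :
  is_expansion_datum rho Lambda D0 -> is_expansion_datum rho Lambda D ->
  refinement D0 D -> is_expansion_datum rho Lambda (weakened_datum D0 D).
Proof.
move=> [H0 Hcov [l1 lL d0 dU] Hgen Hsym] [_ _ [l1' lL' d0' dU'] _ _] [_ [dd LL ll]].
split=> //=.
  by split=> //; apply: le_trans dU; rewrite lee_fin ltW.
move=> i; have [Hlip [Hexp Hball]] := Hgen i; split; [|split].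
- have sub : nbhd Lambda (ed_delta D) `<=` nbhd Lambda (ed_delta D0).
    move=> x [q Lq /ballP qx]; exists q => //; apply/ballP; lra.
  move=> x y /sub Hx /sub Hy; apply: le_trans (Hlip x y Hx Hy) _.
  by rewrite ler_wpM2r// mdist_ge0.
- move=> x y Ux Uy; apply: le_trans (Hexp x y Ux Uy).
  by rewrite ler_wpM2r// mdist_ge0.
- move=> x eta eta0 etad xU y /ballP xy; apply: (Hball x eta) => //; first by lra.
  by apply/ballP; apply: lt_le_trans xy _; rewrite ler_wpM2r// ltW.
Qed.

Lemma code_point_weakened rho D0 D (alpha : nat -> ed_index D0) x k :
  code_point rho (D := weakened_datum D0 D) alpha x k = code_point rho alpha x k.
Proof. by elim: k => //= k ->. Qed.

Lemma weakened_Hom_nbhd rho rho' D0 D K (e : R) : refinement D0 D ->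
  Hom_nbhd D rho K e rho' -> Hom_nbhd (weakened_datum D0 D) rho K e rho'.
Proof. by move=> [[iota [_ Hiota]] _] H i; have [_ /= ->] := Hiota i; apply: H. Qed.

(** Codes of the perturbed [D0] (b = delta) give codes of [rho] at scale 3 delta/4, hence delta/2;
    [D]-codes at delta/2 return to codes of the perturbed [D] (b = delta/2). Every [eta] thus
    reduces to uniformity at delta/2. *)
Lemma unif_meandering_perturbed rho rho' Lambda D0 D N K (e r : R) phi :
  geodesic_space M -> unif_meandering_hyperbolic_with rho Lambda D0 D N ->
  (forall q y, Lambda q -> mdist q y <= (2 * ed_L D + 2) * ed_delta D -> K y) ->
  Hom_nbhd D rho K e rho' -> 0 < e -> e <= 1 - contraction_ratio D ->
  e <= (1 - contraction_ratio D) * r -> r <= ed_delta D / 16 ->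
  (forall g x, Lambda x -> rho' g (phi x) = phi (rho g x)) ->
  (forall x, Lambda x -> mdist x (phi x) <= r) ->
  unif_meandering_hyperbolic_with rho' (phi @` Lambda)
    (perturbed_datum Lambda (weakened_datum D0 D) phi (ed_delta D) (ed_delta D / 8))
    (perturbed_datum Lambda D phi (ed_delta D / 2) (ed_delta D / 16)) N.
Proof.
move=> geo [HD0 HD ref N1 Hrays] HK Hcl e0 e1 er rd phiE phiC.
have HDw := weakened_expansion_datum HD0 HD ref.
have Hclw := weakened_Hom_nbhd ref Hcl.
have d0 := ed_delta_gt0 HD.
split=> //.
- by apply: (perturbed_expansion_datum HDw HK Hclw e0 e1 er rd phiE phiC geo) => /=; lra.
- by apply: (perturbed_expansion_datum HD HK Hcl e0 e1 er rd phiE phiC geo); lra.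
- have [[iota [iota_inj Hiota]] _] := ref; split; last by split=> //=; lra.
  exists iota; split=> // i; have [Hcov Hgen] := Hiota i; split=> //.
  move=> y [q [Lq qU] qy]; exists q => //; split=> // z /ballP qz.
  by apply/Hcov/qU/ballP => /=; lra.
move=> /= eta eta0 etad _ [x Lx <-].
have fwd c : Ray rho D (ed_delta D / 2) x c ->
    Ray rho' (perturbed_datum Lambda D phi (ed_delta D / 2) (ed_delta D / 16)) eta (phi x) c.
  move=> [alpha Hc <-]; exists alpha => //.
  by apply: (is_code_perturbed HD phiE) => //; lra.
have bwd c : Ray rho' (perturbed_datum Lambda (weakened_datum D0 D) phi (ed_delta D)
      (ed_delta D / 8)) eta (phi x) c -> Ray rho D0 (ed_delta D / 2) x c.
  move=> [alpha Hc <-]; exists alpha => // k k0 y /ballP py.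
  apply: (is_code_of_perturbed HDw rd phiE phiC Lx eta0 Hc k0).
  by apply/ballP; rewrite code_point_weakened /=; lra.
move=> c c' /bwd Rc /bwd Rc'.
have dd : 0 < ed_delta D / 2 by lra.
have dd' : ed_delta D / 2 <= ed_delta D by lra.
have [Rc1 Rc1' cc'] := Hrays _ dd dd' x Lx c c' Rc Rc'.
split; [exact: fwd|exact: fwd|].
(* The generators are unchanged, so the word metric and the Hausdorff bounds are the same. *)
elim: cc' => {c c' Rc Rc' Rc1 Rc1'} [c c' [Rc Rc' H]|c|c c' _ IH|c1 c2 c3 _ IH1 _ IH2].
- by apply: rst_step; split=> //; apply: fwd.
- exact: rst_refl.
- exact: rst_sym.
- exact: rst_trans IH1 IH2.
Qed.

Lemma compact_mdist_nbhd Lambda (t : R) : proper_space M -> compact Lambda ->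
  Lambda !=set0 -> exists K, [/\ compact K, Lambda `<=` K &
    forall q y, Lambda q -> mdist q y <= t -> K y].
Proof.
move=> M_proper Lc [x0 Lx0]; have [a a0 Ha] := compact_mdist_bounded x0 Lc.
(* The maximum with 0 keeps [Lambda] inside [K] for negative [t]. *)
exists [set y | mdist x0 y <= a + Num.max 0 t]; split; first exact: M_proper.
  by move=> y Ly /=; apply: le_trans (Ha y Ly) _; rewrite lerDl le_max lexx.
move=> q y Lq qy; apply: mdist_le_sum (Ha q Lq) _.
by rewrite le_max qy orbT.
Qed.

Lemma uniform_cvg_mdist (T : Type) (F : set_system T) (FF : Filter F)
    Lambda (f : T -> M -> M) (g : M -> M) :
  (forall t : R, 0 < t -> F [set u | forall x, Lambda x -> mdist (g x) (f u x) < t]) ->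
  {uniform Lambda, f u @[u --> F] --> g}.
Proof.
move=> H P /uniform_nbhs[E [entE EP]].
move: entE; rewrite -entourage_ballE => -[t /= t0 tE].
apply: filterS (H t t0) => u Hu; apply: EP => x Lx.
by apply: tE; apply/ballP; apply: Hu.
Qed.

End Stability.

Theorem theorem4p4 (R : realType) (M : metricType R) (G : groupType)
    (M_proper : proper_space M) (M_geodesic : geodesic_space M) :
  exists eps : expansion_datum M G -> nat -> R,
  forall (rho : action M G) (Lambda : set M) (D0 D : expansion_datum M G)
    (N : nat),
  meandering_hyperbolic_with rho Lambda D0 D N ->
  0 < eps D N /\
  exists (K : set M) (Lambda' : action M G -> set M)
    (phi : action M G -> M -> M),
  [/\ compact K,
      Lambda `<=` K,
      forall rho', Hom_nbhd D rho K (eps D N) rho' -> compact (Lambda' rho') &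
  [/\ forall rho', Hom_nbhd D rho K (eps D N) rho' ->
        [/\ invariant_set rho' (Lambda' rho'),
            homeo_onto Lambda (Lambda' rho') (phi rho') &
            forall g x, Lambda x -> rho' g (phi rho' x) = phi rho' (rho g x)],
      {uniform Lambda,
        phi rho' @[rho' --> within (Hom_nbhd D rho K (eps D N))
                              (nbhs (rho : hom_space D))] --> phi rho},
      forall rho', Hom_nbhd D rho K (eps D N) rho' ->
        expanding rho' (Lambda' rho') &
      unif_meandering_hyperbolic_with rho Lambda D0 D N ->
        forall rho', Hom_nbhd D rho K (eps D N) rho' ->
        unif_meandering_hyperbolic rho' (Lambda' rho')]].
Proof.
exists stability_eps => rho Lambda D0 D N MH.
have [_ HD _ _ _] := MH.
have [e0 e1 er rd _] := stability_epsP N HD; split=> //.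
have [[Lne Lc _ _] _ _ _ _] := HD.
have [K [Kc LK HK]] := compact_mdist_nbhd ((2 * ed_L D + 2) * ed_delta D) M_proper Lc Lne.
have t1 := contraction_ratio_lt1 HD; have d0 := ed_delta_gt0 HD.
set e := stability_eps D N in e0 e1 er *; set r := stability_radius D N in er rd.
have /choice[phi Hphi] : forall rho', exists phi : M -> M, Hom_nbhd D rho K e rho' ->
    (forall g x, Lambda x -> rho' g (phi x) = phi (rho g x)) /\
    forall e' r', 0 < e' -> e' <= 1 - contraction_ratio D ->
      e' <= (1 - contraction_ratio D) * r' -> r' <= r -> Hom_nbhd D rho K e' rho' ->
      forall x, Lambda x -> mdist x (phi x) <= r'.
  move=> rho'; case: (pselect (Hom_nbhd D rho K e rho')) => [H|nH].
    by have [phi Hphi] := conjugacy_exists M_proper MH HK H; exists phi.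
  by exists id.
have phiE rho' (H : Hom_nbhd D rho K e rho') := proj1 (Hphi rho' H).
have phiC rho' (H : Hom_nbhd D rho K e rho') := proj2 (Hphi rho' H) e r e0 e1 er (lexx r) H.
exists K, (fun rho' => phi rho' @` Lambda), phi; split=> //.
  by move=> rho' H; apply: (conjugacy_compact HD HK H e1 rd (phiE _ H) (phiC _ H)).
split.
- move=> rho' H; split; last exact: phiE.
    exact: (conjugacy_invariant HD (phiE _ H)).
  exact: (conjugacy_homeo HD HK H e1 rd (phiE _ H) (phiC _ H)).
- apply: uniform_cvg_mdist => t t0.
  (* Both conjugacies will be within [r'] of the identity on [Lambda], so 2 r' < t is wanted; [e']
     is the matching closeness. *)
  pose r' := Num.min r (t / 3).
  have r0 : 0 < r by have := lt_le_trans e0 er; rewrite pmulr_rgt0//; lra.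
  have r'0 : 0 < r' by rewrite lt_min r0 /=; lra.
  have r'r : r' <= r by rewrite ge_min lexx.
  have r't : r' <= t / 3 by rewrite ge_min lexx orbT.
  pose e' := (1 - contraction_ratio D) * Num.min 1 r'.
  have m1 : Num.min 1 r' <= 1 by rewrite ge_min lexx.
  have m2 : Num.min 1 r' <= r' by rewrite ge_min lexx orbT.
  have m0 : 0 < Num.min 1 r' by rewrite lt_min ltr01.
  have e'0 : 0 < e' by rewrite mulr_gt0//; lra.
  have e'1 : e' <= 1 - contraction_ratio D by rewrite /e' ler_piMr//; lra.
  have e'r : e' <= (1 - contraction_ratio D) * r' by rewrite /e' ler_wpM2l//; lra.
  have close rho' : Hom_nbhd D rho K e rho' -> Hom_nbhd D rho K e' rho' ->
      forall x, Lambda x -> mdist x (phi rho' x) <= r'.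
    by move=> H H'; apply: (proj2 (Hphi rho' H) e' r').
  (* [rho] lies in its own neighborhoods, so the bound applies to [phi rho] too. *)
  have self a : 0 < a -> Hom_nbhd D rho K a rho by move=> a0 i; rewrite dLipxx lte_fin.
  rewrite /within /=.
  suff sub : Hom_nbhd D rho K e' `<=` [set rho' | Hom_nbhd D rho K e rho' ->
      forall x, Lambda x -> mdist (phi rho x) (phi rho' x) < t].
    exact: (@filterS (hom_space D) _ _ _ _ sub (Hom_nbhd_nbhs rho D Kc e'0)).
  move=> rho' H' H x Lx.
  have := close _ H H' x Lx; have := close _ (self _ e0) (self _ e'0) x Lx.
  rewrite metric_sym => c1 c2; have := metric_triangle (phi rho x) x (phi rho' x); lra.
- move=> rho' H; exists (perturbed_datum Lambda D (phi rho') (ed_delta D) (ed_delta D / 8)).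
  by apply: (perturbed_expansion_datum HD HK H e0 e1 er rd (phiE _ H) (phiC _ H) M_geodesic); lra.
- move=> UMH rho' H; do 3 eexists.
  exact: (unif_meandering_perturbed M_geodesic UMH HK H e0 e1 er rd (phiE _ H) (phiC _ H)).
Qed.
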